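(* Let $\mathcal{H}$ and $\mathcal{G}$ be real Hilbert spaces, let $L\in\mathcal{B}(\mathcal{H},\mathcal{G})$ be bounded below with $\|L\|\leq 1$, let $B\in\mathcal{S}(\mathcal{G})$, and let $\gamma\in\,]0,+\infty[$. Then the following hold: (i) Set $\omega=1+\|B^{-1}\|/\gamma$. Then $L^*\triangleright B\preccurlyeq L\overset{\gamma}{\diamond}B\preccurlyeq\omega(L^*\triangleright B)$. (ii) $L\overset{\gamma}{\bullet}B\preccurlyeq L\overset{\gamma}{\diamond}B$. (iii) Suppose that $A\in\mathcal{S}(\mathcal{G})$ satisfies $A\preccurlyeq B$. Then $L\overset{\gamma}{\diamond}A\preccurlyeq L\overset{\gamma}{\diamond}B$. (iv) Let $\rho\in\,]0,+\infty[$ be such that $\rho\leq\gamma$. Then $L\overset{\gamma}{\diamond}B\preccurlyeq L\overset{\rho}{\diamond}B$.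
   Context: $\mathcal{B}(\mathcal{H},\mathcal{G})$ is the space of bounded linear operators from $\mathcal{H}$ to $\mathcal{G}$ with the operator norm, $\mathcal{B}(\mathcal{H})=\mathcal{B}(\mathcal{H},\mathcal{H})$, and $L^*$ is the adjoint of $L$. $\mathcal{P}(\mathcal{H})$ is the set of self-adjoint $A\in\mathcal{B}(\mathcal{H})$ with $\langle Ax,x\rangle\geq 0$ for all $x\in\mathcal{H}$. For self-adjoint $A,B$, $A\preccurlyeq B$ means $B-A\in\mathcal{P}(\mathcal{H})$. $\mathcal{S}(\mathcal{H})$ is the set of $A\in\mathcal{P}(\mathcal{H})$ for which there exists $\alpha>0$ with $\alpha\,\mathrm{Id}_{\mathcal{H}}\preccurlyeq A$. $L$ is bounded below if there exists $\alpha>0$ such that $\alpha\|x\|\leq\|Lx\|$ for all $x\in\mathcal{H}$. For a set-valued operator $M\colon\mathcal{G}\to 2^{\mathcal{G}}$, $M^{-1}$ is the set-valued inverse ($x\in M^{-1}y\Leftrightarrow y\in Mx$); sums and compositions are taken in the set-valued sense, e.g. $(L^*\circ M\circ L)x=\{L^*y : y\in M(Lx)\}$; a set-valued operator all of whose values are singletons is identified with the corresponding single-valued operator. The parallel composition of $M$ by $L^*$ is $L^*\triangleright M=(L^*\circ M^{-1}\circ L)^{-1}$. For $\gamma\in\,]0,+\infty[$, the resolvent composition is $L\overset{\gamma}{\diamond}M=L^*\triangleright(M+\gamma^{-1}\mathrm{Id}_{\mathcal{G}})-\gamma^{-1}\mathrm{Id}_{\mathcal{H}}$, and the resolvent cocomposition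 is $L\overset{\gamma}{\bullet}M=\bigl(L\overset{1/\gamma}{\diamond}M^{-1}\bigr)^{-1}$. *)

(* Defs.v *)
From HB Require Import structures.
From mathcomp Require Import all_boot all_order all_algebra.
From mathcomp Require Import boolp classical_sets functions reals topology.
From mathcomp Require Import normedtype sequences.

Set Implicit Arguments.
Unset Strict Implicit.
Unset Printing Implicit Defensive.

Import Order.TTheory GRing.Theory Num.Theory.
Import numFieldNormedType.Exports.

Local Open Scope classical_set_scope.
Local Open Scope ring_scope.

HB.mixin Record CompleteNormedModule_isHilbert (R : realType) H
    & CompleteNormedModule R H := {
  inner : {dot H for (idfun : R -> R)} ;
  sqr_normr_inner : forall x : H, `|x| ^+ 2 = inner x x
}.

#[short(type="hilbertType")]
HB.structure Definition Hilbert (R : realType) :=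
  {H of CompleteNormedModule R H & CompleteNormedModule_isHilbert R H}.

Section bounded_operators.
Variable R : realType.
Implicit Types H G : hilbertType R.

Definition bounded_op H G : set (H -> G) :=
  [set L | linear L /\ bounded_fun_norm L].

(* [sup] is 0 on unbounded sets: meaningful only when [bounded_op L]. *)
Definition opnorm H G (L : H -> G) : R :=
  sup [set `|L x| | x in [set x : H | `|x| <= 1]].

Definition bounded_below H G (L : H -> G) : Prop :=
  exists2 alpha : R, 0 < alpha & forall x, alpha * `|x| <= `|L x|.

(* The defining relation has at most one solution, and by Riesz exactly one
   when [bounded_op L]; the default 0 is used only outside that case. *)
Definition adjoint H G (L : H -> G) : G -> H :=
  xget (fun=> 0) [set K : G -> H | forall x y, inner (L x) y = inner x (K y)].

Definition self_adjoint H : set (H -> H) :=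
  [set A | bounded_op A /\ adjoint A = A].

Definition positive_op H : set (H -> H) :=
  [set A | self_adjoint A /\ forall x, 0 <= inner (A x) x].

Definition loewner H (A B : H -> H) : Prop :=
  [/\ self_adjoint A, self_adjoint B & positive_op (fun x => B x - A x)].

Definition strongly_positive_op H : set (H -> H) :=
  [set A | positive_op A /\
     exists2 alpha : R, 0 < alpha & loewner (fun x => alpha *: x) A].

End bounded_operators.

Section set_valued_operators.
Variable R : realType.
Implicit Types H G K : hilbertType R.

Definition sop H G : Type := H -> set G.

Definition sop_of H G (f : H -> G) : sop H G := fun x => [set f x].

Definition sop_inv H G (M : sop H G) : sop G H := fun y => [set x | M x y].

Definition sop_add H G (M N : sop H G) : sop H G :=
  fun x => [set u + v | u in M x & v in N x].

Definition sop_scale H G (c : R) (M : sop H G) : sop H G :=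
  fun x => [set c *: u | u in M x].

Definition sop_comp H G K (N : sop G K) (M : sop H G) : sop H K :=
  fun x => \bigcup_(y in M x) N y.

Definition scaled_id H (c : R) : sop H H := sop_of (fun x : H => c *: x).

(* Inverse of [sop_of] on operators whose values are all singletons. *)
Definition op_of H G (M : sop H G) : H -> G := fun_of_rel (fun=> 0) M.

(* Loewner order for set-valued operators under the identification of
   singleton-valued operators with maps: it includes the claim that both sides
   are singleton-valued, linear, bounded and self-adjoint. *)
Definition sop_loewner H (M N : sop H H) : Prop :=
  exists A B : H -> H, [/\ M = sop_of A, N = sop_of B & loewner A B].

(* [parallel_comp L M] is the parallel composition of M by the adjoint of L. *)
Definition parallel_comp H G (L : H -> G) (M : sop G G) : sop H H :=
  sop_inv (sop_comp (sop_of (adjoint L)) (sop_comp (sop_inv M) (sop_of L))).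

Definition resolvent_comp H G (gamma : R) (L : H -> G) (M : sop G G) :
    sop H H :=
  sop_add (parallel_comp L (sop_add M (scaled_id gamma^-1)))
          (scaled_id (- gamma^-1)).

Definition resolvent_cocomp H G (gamma : R) (L : H -> G) (M : sop G G) :
    sop H H :=
  sop_inv (resolvent_comp (1 / gamma) L (sop_inv M)).

End set_valued_operators.

(* Main.v *)
(** For strongly positive [B], the quadratic form of the parallel composition
    at [x] is [min {<B y, y> | L^* y = x}], hence that of the resolvent
    composition is [min {<B y, y> + (|y|^2 - |x|^2) / gamma | L^* y = x}], where
    [|x| <= |y|] because [|L| <= 1].  Comparing the functions being minimized
    gives (i), (iii) and (iv), with [|y|^2 <= |B^-1| <B y, y>] for the upper
    bound in (i).  For (ii), the form of the cocomposition at [x] is a maximum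
    over [v]; every value of it is below every [y]-value by
    [2 <y, v> <= <B y, y> + <B^-1 v, v>] and
    [|L^* (y + gamma v)| <= |y + gamma v|]. *)
Require Import Defs.
From HB Require Import structures.
From mathcomp Require Import all_boot all_order all_algebra.
From mathcomp Require Import boolp classical_sets functions reals topology.
From mathcomp Require Import normedtype sequences interval_inference.
From mathcomp Require Import ring lra.

Set Implicit Arguments.
Unset Strict Implicit.
Unset Printing Implicit Defensive.

Import Order.TTheory GRing.Theory Num.Theory.
Import numFieldNormedType.Exports.

Local Open Scope classical_set_scope.
Local Open Scope ring_scope.

(** * Symmetry and bilinearity of the real inner product *)

Lemma innerC (R : realType) (H : hilbertType R) (x y : H) :
  inner x y = inner y x.
Proof. by rewrite (hermC inner x y) expr0 mul1r. Qed.

Lemma innerDr (R : realType) (H : hilbertType R) (x y z : H) :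
  inner x (y + z) = inner x y + inner x z.
Proof. exact: linearDr. Qed.

Lemma innerZr (R : realType) (H : hilbertType R) (a : R) (x y : H) :
  inner x (a *: y) = a * inner x y.
Proof. exact: linearZr_LR. Qed.

Lemma innerNr (R : realType) (H : hilbertType R) (x y : H) :
  inner x (- y) = - inner x y.
Proof. by rewrite -scaleN1r innerZr mulN1r. Qed.

Lemma innerDl (R : realType) (H : hilbertType R) (x y z : H) :
  inner (x + y) z = inner x z + inner y z.
Proof. by rewrite !(innerC _ z) innerDr. Qed.

Lemma innerZl (R : realType) (H : hilbertType R) (a : R) (x y : H) :
  inner (a *: x) y = a * inner x y.
Proof. by rewrite !(innerC _ y) innerZr. Qed.

Lemma innerNl (R : realType) (H : hilbertType R) (x y : H) :
  inner (- x) y = - inner x y.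
Proof. by rewrite !(innerC _ y) innerNr. Qed.

Lemma inner0l (R : realType) (H : hilbertType R) (y : H) : inner 0 y = 0.
Proof. by rewrite -(scale0r 0) innerZl mul0r. Qed.

Definition innerE := (innerDl, innerDr, innerNl, innerNr, innerZl, innerZr).

Lemma inner_ge0 (R : realType) (H : hilbertType R) (x : H) : 0 <= inner x x.
Proof. by rewrite -sqr_normr_inner sqr_ge0. Qed.

Lemma innerI (R : realType) (H : hilbertType R) (x y : H) :
  (forall z, inner x z = inner y z) -> x = y.
Proof.
move=> xy; apply/eqP; rewrite -subr_eq0 -normr_eq0 -sqrf_eq0 sqr_normr_inner.
by rewrite innerDl innerNl xy subrr.
Qed.

(** * Algebra of unbundled linear maps *)

Section linear_maps.
Context (R : realType) (H G : lmodType R) (f : H -> G) (f_linear : linear f).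

Lemma linear_add x y : f (x + y) = f x + f y.
Proof. by have := f_linear 1 x y; rewrite !scale1r. Qed.

Lemma linear_zero : f 0 = 0.
Proof. by apply: (addrI (f 0)); rewrite -linear_add !addr0. Qed.

Lemma linear_scale a x : f (a *: x) = a *: f x.
Proof. by have := f_linear a x 0; rewrite linear_zero !addr0. Qed.

Lemma linear_opp x : f (- x) = - f x.
Proof. by rewrite -scaleN1r linear_scale scaleN1r. Qed.

Definition linear_mapE := (linear_add, linear_opp, linear_scale).

End linear_maps.

(** * Cauchy-Schwarz inequalities *)

Lemma discriminant_le (R : realType) (a b c : R) :
  (forall t, 0 <= a + 2 * t * b + t ^+ 2 * c) -> b ^+ 2 <= a * c.
Proof.
move=> quad_ge0.
have a_ge0 : 0 <= a by have := quad_ge0 0; lra.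
have c_ge0 : 0 <= c.
  rewrite leNgt; apply/negP => c_lt0.
  have q : a = - c * (a / - c) by field; rewrite lt_eqF.
  have t_ge0 : 0 <= a / - c by rewrite divr_ge0//; lra.
  (* Adding the values at two opposite points cancels the linear term; with [t = a / - c] the sum is
     [- 2 * (- c) * (1 + t + t ^+ 2)], which is negative. *)
  have := quad_ge0 (1 + a / - c); have := quad_ge0 (- (1 + a / - c)).
  move: (a / - c) q t_ge0 => t -> t_ge0.
  have : 0 < - c * (1 + t + t ^+ 2) by rewrite mulr_gt0//; nra.
  by lra.
have [c0|c_neq0] := eqVneq c 0.
  have [->|b_neq0] := eqVneq b 0; first by rewrite c0; lra.
  (* For [c = 0] the polynomial is affine, and this point gives it the value -1. *)
  have := quad_ge0 (- (a + 1) / (2 * b)); rewrite c0.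
  have -> : 2 * (- (a + 1) / (2 * b)) * b = - (a + 1) by field.
  by lra.
have c_gt0 : 0 < c by rewrite lt_def c_neq0.
(* The vertex of the parabola. *)
have := quad_ge0 (- (b / c)).
have : b = c * (b / c) by field.
by move: (b / c) => t ->; nra.
Qed.

(** The discriminant bound applied to the form of [A] along the line [x + t *: y]. Taking [A = id]
    gives the usual inequality; [A = B^-1] serves for the upper bound in (i). *)
Lemma form_CauchySchwarz (R : realType) (H : hilbertType R) (A : H -> H) :
  linear A -> (forall x y, inner (A x) y = inner x (A y)) ->
  (forall x, 0 <= inner (A x) x) ->
  forall x y, inner (A x) y ^+ 2 <= inner (A x) x * inner (A y) y.
Proof.
move=> A_lin A_sym A_ge0 x y; apply: discriminant_le => t.
have := A_ge0 (x + t *: y); rewrite !(linear_mapE A_lin, innerE).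
by rewrite (A_sym y x) (innerC y); lra.
Qed.

Lemma inner_le_norm (R : realType) (H : hilbertType R) (x y : H) :
  `|inner x y| <= `|x| * `|y|.
Proof.
rewrite -(@ler_pXn2r _ 2) ?nnegrE ?mulr_ge0 // exprMn !sqr_normr_inner.
rewrite real_normK ?num_real //.
exact: (@form_CauchySchwarz _ H id _ _ (@inner_ge0 R H)).
Qed.

(** * Bounded operators and the operator norm *)

Lemma bounded_op_bound (R : realType) (H G : hilbertType R) (L : H -> G) :
  bounded_op L -> exists2 M : R, 0 < M & forall x, `|L x| <= M * `|x|.
Proof.
move=> [L_lin /(_ 1)[M LM]].
have M_ge0 : 0 <= M by apply: le_trans (LM 0 _); rewrite ?normr0.
(* The bound on the unit ball may be 0; adding 1 makes it positive. *)
exists (M + 1) => [|x]; first by lra.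
have [->|x0] := eqVneq x 0; first by rewrite linear_zero// !normr0 mulr0.
have x_gt0 : 0 < `|x| by rewrite normr_gt0.
have : `|L (`|x|^-1 *: x)| <= M.
  by apply: LM; rewrite normrZ normfV normr_id mulVf// gt_eqF.
rewrite linear_scale// normrZ normfV normr_id ler_pdivrMl// mulrC => /le_trans.
by apply; rewrite ler_wpM2r//; lra.
Qed.

Lemma bound_bounded_op (R : realType) (H G : hilbertType R) (L : H -> G) M :
  linear L -> (forall x, `|L x| <= M * `|x|) -> bounded_op L.
Proof.
move=> L_lin LM; split=> // r; exists (`|M| * r) => x xr.
apply: le_trans (LM x) _; apply: (@le_trans _ _ (`|M| * `|x|)).
  by rewrite ler_wpM2r// ler_norm.
by rewrite ler_wpM2l.
Qed.

(** Normalizing [x] gives a member of the set whose [sup] is [opnorm L]; boundedness of [L] bounds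
    that set, so its [sup] is a genuine supremum. *)
Lemma norm_le_opnorm (R : realType) (H G : hilbertType R) (L : H -> G) x :
  bounded_op L -> `|L x| <= opnorm L * `|x|.
Proof.
move=> L_bd; have [L_lin _] := L_bd; have [M M_gt0 LM] := bounded_op_bound L_bd.
have [->|x0] := eqVneq x 0; first by rewrite linear_zero// !normr0 mulr0.
have x_gt0 : 0 < `|x| by rewrite normr_gt0.
rewrite mulrC -ler_pdivrMl//.
have -> : `|x|^-1 * `|L x| = `|L (`|x|^-1 *: x)|.
  by rewrite linear_scale// normrZ normfV normr_id.
apply: ub_le_sup; last first.
  by exists (`|x|^-1 *: x) => //=; rewrite normrZ normfV normr_id mulVf// gt_eqF.
exists M => _ [z /= z_le1 <-]; apply: le_trans (LM z) _.
by rewrite -[leRHS]mulr1 ler_wpM2l// ltW.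
Qed.

(** * Solving symmetric coercive equations by energy minimization *)

Lemma cvg_innerl (R : realType) (H : hilbertType R) (u : nat -> H) (l z : H) :
  u @ \oo --> l -> (fun n => inner (u n) z) @ \oo --> inner l z.
Proof.
move=> ul; apply/cvgrPdist_le => e e_gt0.
have d_gt0 : 0 < e / (`|z| + 1) by rewrite divr_gt0// ltr_wpDl.
move/cvgrPdist_le/(_ _ d_gt0): ul; apply: filterS => n ule.
rewrite -innerNl -innerDl; apply: le_trans (inner_le_norm _ _) _.
apply: (@le_trans _ _ (e / (`|z| + 1) * `|z|)); first by rewrite ler_wpM2r.
rewrite mulrAC ler_pdivrMr ?ltr_wpDl// ler_wpM2l ?ltW//; lra.
Qed.

(* The solution minimizes the energy [<A x, x> - 2 f x]: by the parallelogram
   identity and coercivity, every minimizing sequence is Cauchy. *)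
Lemma symmetric_lax_milgram (R : realType) (H : hilbertType R) (A : H -> H)
    (f : H -> R) (alpha N : R) :
  linear A -> (forall x y, inner (A x) y = inner x (A y)) ->
  0 < alpha -> (forall x, alpha * `|x| ^+ 2 <= inner (A x) x) ->
  (forall x y, f (x + y) = f x + f y) -> (forall a x, f (a *: x) = a * f x) ->
  (forall x, `|f x| <= N * `|x|) ->
  exists x, forall y, inner (A x) y = f y.
Proof.
move=> A_lin A_sym alpha_gt0 A_ge fD fZ f_le.
pose J x := inner (A x) x - 2 * f x.
(* Completing the square: [alpha * r ^+ 2 - 2 * N * r] is at least [- (N ^+ 2 / alpha)], with [r]
   the norm of [x]. *)
have J_ge x : - (N ^+ 2 / alpha) <= J x.
  have f_leN : f x <= N * `|x| by apply: le_trans (f_le x); exact: ler_norm.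
  have := A_ge x; rewrite /J; move: `|x| f_leN => r f_leN.
  have -> : N = alpha * (N / alpha) by field; rewrite gt_eqF.
  have -> : (alpha * (N / alpha)) ^+ 2 / alpha = alpha * (N / alpha) ^+ 2.
    by field; rewrite gt_eqF.
  have : N * r = alpha * (N / alpha) * r by field; rewrite gt_eqF.
  move: (N / alpha) => s Nr Ax_ge.
  by have := mulr_ge0 (ltW alpha_gt0) (sqr_ge0 (r - s)); lra.
have J_inf : has_inf (range J).
  split; first by exists (J 0), 0.
  by exists (- (N ^+ 2 / alpha)) => _ [x _ <-].
have [m [J_gem J_ltm]] :
    exists m : R, (forall x, m <= J x) /\
      forall e : R, 0 < e -> exists x, J x < m + e.
  exists (inf (range J)); split=> [x|e e_gt0].
    by apply: ge_inf; [exact: J_inf.2 | exists x].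
  by have [_ [x _ <-] ?] := inf_adherent e_gt0 J_inf; exists x.
have J_ltSn (n : nat) : exists x, J x < m + n.+1%:R^-1.
  by apply: J_ltm; rewrite invr_gt0.
have [u Ju] := choice J_ltSn.
(* The form of [A] at [x - y] equals [2 * J x + 2 * J y] minus four times [J] at the midpoint, where
   [J] is at least [m]. *)
have half x y : alpha * `|x - y| ^+ 2 <= 2 * (J x - m) + 2 * (J y - m).
  apply: le_trans (A_ge _) _; have := J_gem (2^-1 *: (x + y)).
  rewrite /J fZ fD !(linear_mapE A_lin, innerE) (A_sym y x) (innerC y).
  by lra.
have u_cauchy : cauchy (u @ \oo).
  apply: cauchy_exP => e e_gt0.
  (* In [half], two deviations below this threshold, each counted twice, sum to less than
     [alpha * e ^+ 2]. *)
  have d_gt0 : 0 < alpha * e ^+ 2 / 4.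
    by rewrite divr_gt0// mulr_gt0// exprn_gt0.
  have [k _ k_le] := near_infty_natSinv_lt (PosNum d_gt0).
  have Ju_lt n : (k <= n)%N -> J (u n) - m < alpha * e ^+ 2 / 4.
    move=> kn; rewrite ltrBlDl; apply: lt_trans (Ju n) _.
    by rewrite ltrD2l; exact: k_le.
  exists (u k); exists k => //= n kn; rewrite -ball_normE /ball_ /=.
  have e_ge0 := ltW e_gt0.
  rewrite -(@ltr_pXn2r _ 2) ?nnegrE// -(ltr_pM2l alpha_gt0).
  apply: le_lt_trans (half _ _) _.
  by have := Ju_lt k (leqnn k); have := Ju_lt n kn; lra.
have [l ul] : exists l : H, u @ \oo --> l.
  by exists (lim (u @ \oo)); exact: (cauchy_cvg _ u_cauchy).
exists l => y; apply/eqP; rewrite -subr_eq0 -sqrf_eq0; apply/eqP.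
(* Euler equation up to an error: [J (u n + t *: y) - m] is a nonnegative quadratic in [t] whose
   linear coefficient is twice the residual, so the discriminant bounds the residual by the gap
   [J (u n) - m]. *)
have g_le n : (inner (u n) (A y) - f y) ^+ 2 <= n.+1%:R^-1 * inner (A y) y.
  apply: (@le_trans _ _ ((J (u n) - m) * inner (A y) y)).
    apply: discriminant_le => t.
    have := J_gem (u n + t *: y).
    rewrite /J fD fZ !(linear_mapE A_lin, innerE).
    by rewrite (A_sym (u n) y) (innerC (A y) (u n)); lra.
  rewrite ler_wpM2r//; last by rewrite lerBlDl ltW.
  by apply: le_trans (A_ge y); rewrite mulr_ge0 ?sqr_ge0 ?ltW.
have g_cvg : (fun n => (inner (u n) (A y) - f y) ^+ 2) @ \oo
    --> (inner (A l) y - f y) ^+ 2.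
  rewrite A_sym; have cv : (fun n => inner (u n) (A y) - f y) @ \oo -->
      inner l (A y) - f y by apply: cvgB; [exact: cvg_innerl|exact: cvg_cst].
  by under eq_fun do rewrite expr2; rewrite expr2; exact: cvgM.
have h_cvg : (fun n => n.+1%:R^-1 * inner (A y) y) @ \oo --> 0 * inner (A y) y.
  by apply: cvgM; [exact: cvg_harmonic|exact: cvg_cst].
apply/le_anti; rewrite sqr_ge0 andbT -[leRHS](mul0r (inner (A y) y)).
by apply: ler_cvg_to g_cvg h_cvg _; near=> n; exact: g_le.
Unshelve. all: by end_near. Qed.

(** * Existence and boundedness of adjoints *)

Lemma adjoint_uniq (R : realType) (H G : hilbertType R) (L : H -> G)
    (K : G -> H) :
  (forall x y, inner (L x) y = inner x (K y)) -> adjoint L = K.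
Proof.
move=> LK; apply: xget_unique => //= K' LK'.
by apply/funext => y; apply: innerI => z; rewrite innerC -LK' LK innerC.
Qed.

(** Riesz representation of [x |-> inner (L x) y], obtained from the minimization result with
    [A = id] and [alpha = 1]. *)
Lemma innerA (R : realType) (H G : hilbertType R) (L : H -> G) :
  bounded_op L -> forall x y, inner (L x) y = inner x (adjoint L y).
Proof.
move=> L_bd; have [L_lin _] := L_bd; have [M M_gt0 LM] := bounded_op_bound L_bd.
suff K_ex y : {z | forall x, inner (L x) y = inner x z}.
  have LK x y : inner (L x) y = inner x (sval (K_ex y)).
    by case: (K_ex y).
  by rewrite (adjoint_uniq LK).
apply: cid.
have [|||x|x z|a x|x|z zE] :=
  @symmetric_lax_milgram _ H id (fun x => inner (L x) y) 1 (M * `|y|).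
- by [].
- by [].
- by [].
- by rewrite mul1r sqr_normr_inner.
- by rewrite linear_add// innerDl.
- by rewrite linear_scale// innerZl.
- apply: le_trans (inner_le_norm _ _) _.
  by rewrite mulrAC ler_wpM2r.
by exists z => x; rewrite -zE innerC.
Qed.

(** With [K = adjoint L], [|K y|^2 = <L (K y), y> <= M |K y| |y|]; dividing by [|K y|] transfers the
    bound [M] from [L] to [K]. *)
Lemma adjoint_bounded_op (R : realType) (H G : hilbertType R) (L : H -> G) :
  bounded_op L -> bounded_op (adjoint L).
Proof.
move=> L_bd; have [M M_gt0 LM] := bounded_op_bound L_bd.
apply: (@bound_bounded_op _ _ _ _ M) => [a x y|y].
  apply: innerI => z; rewrite innerC -innerA// !innerE.
  by rewrite !(innerC (adjoint L _) z) -!innerA.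
have [->|Ly0] := eqVneq (adjoint L y) 0.
  by rewrite normr0 mulr_ge0// ltW.
have Ly_gt0 : 0 < `|adjoint L y| by rewrite normr_gt0.
rewrite -(ler_pM2l Ly_gt0) -expr2 sqr_normr_inner -innerA//.
apply: le_trans (ler_norm _) _; apply: le_trans (inner_le_norm _ _) _.
by rewrite mulrA ler_wpM2r// mulrC.
Qed.

(** * Self-adjoint and strongly positive operators *)

Lemma self_adjointP (R : realType) (H : hilbertType R) (A : H -> H) :
  self_adjoint A <->
  bounded_op A /\ forall x y, inner (A x) y = inner x (A y).
Proof.
split=> -[A_bd A_sym]; split=> //; last exact: adjoint_uniq.
by move=> x y; rewrite innerA// A_sym.
Qed.

Lemma bounded_op_lincomb (R : realType) (H G : hilbertType R) (a b : R)
    (K L : H -> G) :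
  bounded_op K -> bounded_op L -> bounded_op (fun x => a *: K x + b *: L x).
Proof.
move=> K_bd L_bd; have [M M_gt0 KM] := bounded_op_bound K_bd.
have [N N_gt0 LN] := bounded_op_bound L_bd.
apply: (@bound_bounded_op _ _ _ _ (`|a| * M + `|b| * N)) => [c x y|x].
  rewrite K_bd.1 L_bd.1 !scalerDr !scalerA !(mulrC c) -!scalerA.
  exact: addrACA.
apply: le_trans (ler_normD _ _) _; rewrite !normrZ mulrDl -!mulrA.
by rewrite lerD// ler_wpM2l.
Qed.

Lemma self_adjoint_lincomb (R : realType) (H : hilbertType R) (a b : R)
    (A B : H -> H) :
  self_adjoint A -> self_adjoint B ->
  self_adjoint (fun x => a *: A x + b *: B x).
Proof.
move=> /self_adjointP[A_bd A_sym] /self_adjointP[B_bd B_sym].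
apply/self_adjointP; split=> [|x y]; first exact: bounded_op_lincomb.
by rewrite !innerE A_sym B_sym.
Qed.

Lemma self_adjoint_id (R : realType) (H : hilbertType R) :
  self_adjoint (@id H).
Proof.
apply/self_adjointP; split=> //; apply: (@bound_bounded_op _ _ _ _ 1) => // x.
by rewrite mul1r.
Qed.

(** Self-adjointness passes to the difference, so what remains is a comparison of quadratic
    forms. *)
Lemma loewnerP (R : realType) (H : hilbertType R) (A B : H -> H) :
  loewner A B <-> [/\ self_adjoint A, self_adjoint B &
    forall x, inner (A x) x <= inner (B x) x].
Proof.
split=> -[A_sa B_sa AB]; split=> //.
  by move=> x; have := AB.2 x; rewrite !innerE subr_ge0.
split=> [|x]; last by rewrite !innerE subr_ge0.
have := self_adjoint_lincomb 1 (-1) B_sa A_sa; congr self_adjoint.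
by apply/funext => x; rewrite scale1r scaleN1r.
Qed.

Lemma strongly_positive_opP (R : realType) (H : hilbertType R) (A : H -> H) :
  strongly_positive_op A <-> self_adjoint A /\
  exists2 alpha, 0 < alpha & forall x, alpha * `|x| ^+ 2 <= inner (A x) x.
Proof.
split=> [[[A_sa _] [alpha alpha_gt0 /loewnerP[_ _ A_ge]]]|
         [A_sa [alpha alpha_gt0 A_ge]]].
  split=> //; exists alpha => // x; apply: le_trans (A_ge x).
  by rewrite innerZl sqr_normr_inner.
split.
  split=> // x; apply: le_trans (A_ge x).
  by rewrite mulr_ge0 ?sqr_ge0 ?ltW.
exists alpha => //; apply/loewnerP; split=> // [|x].
  have := self_adjoint_lincomb alpha 0 (self_adjoint_id H) (self_adjoint_id H).
  by congr self_adjoint; apply/funext => x; rewrite scale0r addr0.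
by rewrite innerZl -sqr_normr_inner.
Qed.

(** Coercivity gives injectivity, and minimization with the functional [inner y] gives
    surjectivity. *)
Lemma strongly_positive_op_inv (R : realType) (H : hilbertType R)
    (A : H -> H) : strongly_positive_op A ->
  exists T, [/\ strongly_positive_op T, cancel A T & cancel T A].
Proof.
move=> /strongly_positive_opP[/self_adjointP[A_bd A_sym]].
move=> [alpha alpha_gt0 A_ge]; have [A_lin _] := A_bd.
have [M M_gt0 AM] := bounded_op_bound A_bd.
have A_inj : injective A.
  move=> x y Axy; apply/eqP; rewrite -subr_eq0 -normr_eq0 -sqrf_eq0.
  rewrite eq_le sqr_ge0 andbT -(pmulr_rle0 _ alpha_gt0).
  apply: le_trans (A_ge _) _.
  by rewrite !(linear_mapE A_lin) Axy subrr inner0l.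
have A_surj y : exists x, A x = y.
  have [|x xE] := symmetric_lax_milgram A_lin A_sym alpha_gt0 A_ge
    (innerDr y) _ (inner_le_norm y).
    by move=> a x; exact: innerZr.
  by exists x; apply: innerI => z; exact: xE.
have [T AT] := choice A_surj.
have TA : cancel A T by move=> x; apply: A_inj; rewrite AT.
exists T; split=> //; apply/strongly_positive_opP; split.
  apply/self_adjointP; split=> [|x y]; last by rewrite -{2}(AT x) A_sym AT.
  apply: (@bound_bounded_op _ _ _ _ alpha^-1) => [a x y|x].
    by apply: A_inj; rewrite !(linear_mapE A_lin, AT).
  have [->|Tx0] := eqVneq (T x) 0.
    by rewrite normr0 mulr_ge0// invr_ge0 ltW.
  have Tx_gt0 : 0 < `|T x| by rewrite normr_gt0.
  rewrite ler_pdivlMl// -(ler_pM2r Tx_gt0) -mulrA -expr2.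
  apply: le_trans (A_ge _) _; rewrite AT.
  by apply: le_trans (ler_norm _) _; exact: inner_le_norm.
(* From [x = A (T x)] come [|x| <= M |T x|] and [<T x, x> >= alpha |T x|^2]. *)
exists (alpha / M ^+ 2) => [|x]; first by rewrite divr_gt0// exprn_gt0.
apply: (@le_trans _ _ (alpha * `|T x| ^+ 2)); last first.
  by rewrite innerC -{2}(AT x); exact: A_ge.
rewrite -mulrA ler_pM2l// ler_pdivrMl ?exprn_gt0// -exprMn.
by rewrite ler_pXn2r ?nnegrE ?mulr_ge0 ?(ltW M_gt0)// -{1}(AT x).
Qed.

(** The form at [x] is that of [T] at [L x], hence at least
    [alpha |L x|^2 >= alpha beta^2 |x|^2]. *)
Lemma strongly_positive_compression (R : realType) (H G : hilbertType R)
    (L : H -> G) (T : G -> G) :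
  bounded_op L -> bounded_below L -> strongly_positive_op T ->
  strongly_positive_op (fun x => adjoint L (T (L x))).
Proof.
move=> L_bd [beta beta_gt0 L_ge] /strongly_positive_opP[].
move=> /self_adjointP[T_bd T_sym] [alpha alpha_gt0 T_ge].
have K_bd := adjoint_bounded_op L_bd.
apply/strongly_positive_opP; split.
  apply/self_adjointP; split=> [|x y]; last first.
    by rewrite innerC -innerA// innerC T_sym innerA.
  have [M M_gt0 LM] := bounded_op_bound L_bd.
  have [N N_gt0 TN] := bounded_op_bound T_bd.
  have [P P_gt0 KP] := bounded_op_bound K_bd.
  apply: (@bound_bounded_op _ _ _ _ (P * N * M)) => [a x y|x].
    by rewrite L_bd.1 T_bd.1 K_bd.1.
  apply: le_trans (KP _) _; rewrite -!mulrA ler_pM2l//.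
  by apply: le_trans (TN _) _; rewrite ler_pM2l.
exists (alpha * beta ^+ 2) => [|x]; first by rewrite mulr_gt0// exprn_gt0.
rewrite innerC -innerA// innerC; apply: le_trans (T_ge _).
rewrite -mulrA ler_pM2l// -exprMn ler_pXn2r ?nnegrE//.
by rewrite mulr_ge0// ltW.
Qed.

(** * Set-valued operations on single-valued operators *)

Lemma sop_inv_of (R : realType) (H G : hilbertType R) (f : H -> G)
    (g : G -> H) :
  cancel f g -> cancel g f -> sop_inv (sop_of f) = sop_of g.
Proof.
move=> fK gK; apply/funext => y; apply/seteqP; split=> x /= [+].
  by move=> ->; rewrite /sop_of /= fK.
by move=> ->; rewrite /sop_inv /sop_of /= gK.
Qed.

Lemma sop_comp_of (R : realType) (H G K : hilbertType R) (g : G -> K)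
    (f : H -> G) : sop_comp (sop_of g) (sop_of f) = sop_of (g \o f).
Proof. by apply/funext => x; rewrite /sop_comp bigcup_set1. Qed.

Lemma sop_add_of (R : realType) (H G : hilbertType R) (f g : H -> G) :
  sop_add (sop_of f) (sop_of g) = sop_of (fun x => f x + g x).
Proof.
apply/funext => x; apply/seteqP; split=> [_ [_ -> [_ -> <-]] //|_ ->].
by exists (f x) => //; exists (g x).
Qed.

Lemma sop_scale_of (R : realType) (H G : hilbertType R) (c : R) (f : H -> G) :
  sop_scale c (sop_of f) = sop_of (fun x => c *: f x).
Proof. by apply/funext => x; rewrite /sop_scale image_set1. Qed.

Lemma op_of_sop_of (R : realType) (H G : hilbertType R) (f : H -> G) :
  op_of (sop_of f) = f.
Proof. by apply/funext => x; apply: xget_unique. Qed.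

Lemma sop_loewner_of (R : realType) (H : hilbertType R) (A B : H -> H) :
  self_adjoint A -> self_adjoint B ->
  (forall x, inner (A x) x <= inner (B x) x) ->
  sop_loewner (sop_of A) (sop_of B).
Proof. by move=> A_sa B_sa AB; exists A, B; split=> //; apply/loewnerP. Qed.

(** * Compositions as constrained minima *)

(** Here [C] is the inverse of [L^* B^-1 L], and the minimum over the fibre of [x] is attained at
    [y0 = B^-1 L C x]. For any other [y] in the fibre, [<B y0, y> = <C x, x>], so
    [<B y, y> - <C x, x>] is the form of [B] at [y - y0]. *)
Lemma parallel_comp_variational (R : realType) (H G : hilbertType R)
    (L : H -> G) (B : G -> G) :
  bounded_op L -> bounded_below L -> strongly_positive_op B ->
  exists C, [/\ parallel_comp L (sop_of B) = sop_of C,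
    strongly_positive_op C,
    forall y, inner (C (adjoint L y)) (adjoint L y) <= inner (B y) y &
    forall x, exists2 y, adjoint L y = x & inner (B y) y = inner (C x) x].
Proof.
move=> L_bd L_below B_sp.
have [T [T_sp BK TK]] := strongly_positive_op_inv B_sp.
have [C [C_sp LTLK CK]] := strongly_positive_op_inv
  (strongly_positive_compression L_bd L_below T_sp).
have [/self_adjointP[B_bd B_sym] [beta beta_gt0 B_ge]] :=
  (strongly_positive_opP B).1 B_sp.
have minimum x : inner (B (T (L (C x)))) (T (L (C x))) = inner (C x) x.
  by rewrite TK innerA// CK.
exists C; split=> // [|y|x]; last by exists (T (L (C x))).
  rewrite /parallel_comp (sop_inv_of BK TK) !sop_comp_of.
  exact: (sop_inv_of LTLK CK).
set x := adjoint L y; pose y0 := T (L (C x)).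
have : 0 <= inner (B (y - y0)) (y - y0).
  by apply: le_trans (B_ge _); rewrite mulr_ge0 ?sqr_ge0 ?ltW.
have y0y : inner (B y0) y = inner (C x) x by rewrite TK innerA.
rewrite !(linear_mapE B_bd.1, innerE) minimum.
rewrite (B_sym y y0) (innerC y (B y0)) y0y.
by lra.
Qed.

(** Expand [|L x - y|^2 >= 0] at [x = L^* y] and use [|L x| <= |x|]. *)
Lemma adjoint_contraction (R : realType) (H G : hilbertType R) (L : H -> G) y :
  bounded_op L -> opnorm L <= 1 ->
  inner (adjoint L y) (adjoint L y) <= inner y y.
Proof.
move=> L_bd L_le1; set x := adjoint L y.
have Lx_le : inner (L x) (L x) <= inner x x.
  rewrite -!sqr_normr_inner ler_pXn2r ?nnegrE//.
  apply: le_trans (norm_le_opnorm x L_bd) _.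
  by rewrite -[leRHS]mul1r ler_wpM2r.
have := inner_ge0 (L x - y).
rewrite !innerE (innerC y (L x)) (innerA L_bd x y) -/x.
by lra.
Qed.

(** The previous formula for [B + gamma^-1 Id], with [gamma^-1 |x|^2] subtracted. *)
Lemma resolvent_comp_variational (R : realType) (H G : hilbertType R)
    (L : H -> G) (B : G -> G) (gamma : R) :
  bounded_op L -> bounded_below L -> opnorm L <= 1 ->
  strongly_positive_op B -> 0 < gamma ->
  exists D, [/\ resolvent_comp gamma L (sop_of B) = sop_of D,
    strongly_positive_op D,
    forall y, inner (D (adjoint L y)) (adjoint L y) <= inner (B y) y +
      gamma^-1 * (inner y y - inner (adjoint L y) (adjoint L y)) &
    forall x, exists2 y, adjoint L y = x &
      inner (D x) x = inner (B y) y + gamma^-1 * (inner y y - inner x x)].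
Proof.
move=> L_bd L_below L_le1 /strongly_positive_opP[B_sa [beta beta_gt0 B_ge]].
move=> gamma_gt0; have g_gt0 : 0 < gamma^-1 by rewrite invr_gt0.
pose B' y := B y + gamma^-1 *: y.
have B'_sp : strongly_positive_op B'.
  apply/strongly_positive_opP; split.
    have := self_adjoint_lincomb 1 gamma^-1 B_sa (self_adjoint_id G).
    by congr self_adjoint; apply/funext => y; rewrite scale1r.
  exists beta => // y; apply: le_trans (B_ge y) _.
  by rewrite innerDl innerZl lerDl mulr_ge0 ?inner_ge0 ?ltW.
have [C [CE /strongly_positive_opP[C_sa _] C_le C_min]] :=
  parallel_comp_variational L_bd L_below B'_sp.
pose D x := C x + (- gamma^-1) *: x.
have D_min x : exists2 y, adjoint L y = x &
    inner (D x) x = inner (B y) y + gamma^-1 * (inner y y - inner x x).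
  have [y yx] := C_min x; rewrite /D /B' !innerE => <-.
  by exists y => //; lra.
exists D; split=> [||y|//].
- by rewrite /resolvent_comp /scaled_id sop_add_of CE sop_add_of.
- apply/strongly_positive_opP; split.
    have := self_adjoint_lincomb 1 (- gamma^-1) C_sa (self_adjoint_id H).
    by congr self_adjoint; apply/funext => x; rewrite scale1r.
  (* The constant of [B] survives: at the minimizer [y] the form is at least
     [<B y, y> >= beta |y|^2 >= beta |x|^2]. *)
  exists beta => // x; have [y <- ->] := D_min x.
  have Ly_le := adjoint_contraction y L_bd L_le1.
  apply: (@le_trans _ _ (inner (B y) y)).
    apply: le_trans (B_ge y); rewrite !sqr_normr_inner.
    by rewrite ler_wpM2l// ltW.
  by rewrite lerDl mulr_ge0 ?subr_ge0// ltW.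
by have := C_le y; rewrite /D /B' !innerE; lra.
Qed.

(** * The four comparisons *)

(** Cauchy-Schwarz for the form of [T = B^-1] at [B y] and [y] gives [|y|^4 <= <B y, y> <T y, y>];
    then bound [<T y, y>] by [opnorm T * |y|^2] and divide by [|y|^2]. *)
Lemma inner_inv_le_opnorm (R : realType) (G : hilbertType R) (B T : G -> G) :
  strongly_positive_op T -> cancel B T ->
  forall y, inner y y <= opnorm T * inner (B y) y.
Proof.
move=> /strongly_positive_opP[/self_adjointP[T_bd T_sym]].
move=> [alpha alpha_gt0 T_ge] BK y.
have T_ge0 z : 0 <= inner (T z) z.
  by apply: le_trans (T_ge z); rewrite mulr_ge0 ?sqr_ge0 ?ltW.
have [->|y0] := eqVneq y 0; first by rewrite inner0l innerC inner0l mulr0.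
have y_gt0 : 0 < inner y y by rewrite -sqr_normr_inner exprn_gt0// normr_gt0.
have := form_CauchySchwarz T_bd.1 T_sym T_ge0 (B y) y.
rewrite BK => CS; have By_ge0 := T_ge0 (B y); rewrite BK in By_ge0.
have Ty_le : inner (T y) y <= opnorm T * inner y y.
  apply: le_trans (ler_norm _) _; apply: le_trans (inner_le_norm _ _) _.
  by rewrite -sqr_normr_inner expr2 mulrA ler_wpM2r// norm_le_opnorm.
rewrite -(ler_pM2r y_gt0) -expr2; apply: le_trans CS _.
by rewrite (innerC (B y)) (mulrC (opnorm T)) -mulrA ler_wpM2l.
Qed.

Theorem corollary3p4 (R : realType) (H G : hilbertType R)
    (L : H -> G) (B : G -> G) (gamma : R)
    (L_bounded : bounded_op L) (L_below : bounded_below L)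
    (L_norm : opnorm L <= 1)
    (B_pos : strongly_positive_op B) (gamma_gt0 : 0 < gamma) :
  [/\ (* (i) *)
      (let omega : R := 1 + opnorm (op_of (sop_inv (sop_of B))) / gamma in
       sop_loewner (parallel_comp L (sop_of B))
                   (resolvent_comp gamma L (sop_of B)) /\
       sop_loewner (resolvent_comp gamma L (sop_of B))
                   (sop_scale omega (parallel_comp L (sop_of B)))),
      (* (ii) *)
      sop_loewner (resolvent_cocomp gamma L (sop_of B))
                  (resolvent_comp gamma L (sop_of B)),
      (* (iii) *)
      (forall A : G -> G, strongly_positive_op A -> loewner A B ->
       sop_loewner (resolvent_comp gamma L (sop_of A))
                   (resolvent_comp gamma L (sop_of B))) &
      (* (iv) *)
      (forall rho : R, 0 < rho -> rho <= gamma ->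
       sop_loewner (resolvent_comp gamma L (sop_of B))
                   (resolvent_comp rho L (sop_of B)))].
Proof.
have Ladj_le y := adjoint_contraction y L_bounded L_norm.
have g_gt0 : 0 < gamma^-1 by rewrite invr_gt0.
have [D [DE D_sp D_le D_min]] :=
  resolvent_comp_variational L_bounded L_below L_norm B_pos gamma_gt0.
have [T [T_sp BK TK]] := strongly_positive_op_inv B_pos.
have [D_sa _] := (strongly_positive_opP D).1 D_sp.
have [/self_adjointP[B_bd B_sym] [beta beta_gt0 B_ge]] :=
  (strongly_positive_opP B).1 B_pos.
split.
- rewrite (sop_inv_of BK TK) op_of_sop_of DE.
  have [C [-> /strongly_positive_opP[C_sa _] C_le C_min]] :=
    parallel_comp_variational L_bounded L_below B_pos.
  split.
    (* A minimizer for [D] is a competitor for [C], and the penalty term is nonnegative. *)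
    apply: sop_loewner_of => // x; have [y <- ->] := D_min x.
    apply: le_trans (C_le y) _.
    by rewrite lerDl mulr_ge0 ?subr_ge0// ltW.
  rewrite sop_scale_of; set omega := 1 + _.
  apply: sop_loewner_of => // [|x].
    have := self_adjoint_lincomb omega 0 C_sa C_sa.
    by congr self_adjoint; apply/funext => x; rewrite scale0r addr0.
  (* Conversely, a minimizer for [C] is a competitor for [D]; its penalty is at most
     [|y|^2 / gamma]. *)
  have [y <- yC] := C_min x; rewrite innerZl -yC.
  apply: le_trans (D_le y) _; rewrite /omega mulrDl mul1r lerD2l mulrAC mulrC.
  rewrite ler_pM2r//; apply: le_trans (inner_inv_le_opnorm T_sp BK y).
  by rewrite gerBl inner_ge0.
- have inv_gamma_gt0 : 0 < 1 / gamma by rewrite div1r.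
  have [E [EE E_sp _ E_min]] :=
    resolvent_comp_variational L_bounded L_below L_norm T_sp inv_gamma_gt0.
  have [F [/strongly_positive_opP[F_sa _] EK FK]] :=
    strongly_positive_op_inv E_sp.
  rewrite /resolvent_cocomp (sop_inv_of BK TK) EE (sop_inv_of EK FK) DE.
  apply: sop_loewner_of => // x.
  (* Since [E (F x) = x], the form of the cocomposition [F] at [x] is that of [E] at [F x], and [v]
     attains it, with [L^* v = F x]. *)
  have [y yx ->] := D_min x; have [v vu] := E_min (F x).
  rewrite FK div1r invrK -vu -yx (innerC (adjoint L y)) => Fx.
  (* Young's inequality for [B], and [Id - L L^* >= 0] tested at
     [y + gamma v]. *)
  have young : 0 <= inner (B (y - T v)) (y - T v).
    by apply: le_trans (B_ge _); rewrite mulr_ge0 ?sqr_ge0 ?ltW.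
  have := Ladj_le (y + gamma *: v).
  move: young.
  rewrite !(linear_mapE B_bd.1) !(linear_mapE (adjoint_bounded_op L_bounded).1).
  rewrite !innerE TK (B_sym y (T v)) TK (innerC v y) (innerC v (T v)).
  rewrite (innerC (adjoint L y) (adjoint L v)).
  set p := inner (adjoint L v) (adjoint L y) in Fx *.
  set q := inner (adjoint L v) (adjoint L v) in Fx *.
  set r := inner (adjoint L y) (adjoint L y).
  move=> young contr.
  (* After multiplication by [gamma], the goal is [contr] plus [gamma] times [young], with [Fx] used
     to absorb one of the two copies of [p]. *)
  rewrite -(ler_pM2l gamma_gt0) mulrDr mulrA divff ?gt_eqF//.
  by nra.
- move=> A A_sp /loewnerP[A_sa _ AB].
  have [D' [-> /strongly_positive_opP[D'_sa _] D'_le _]] :=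
    resolvent_comp_variational L_bounded L_below L_norm A_sp gamma_gt0.
  (* The minimizer for [B] is a competitor for [A], with the same penalty. *)
  rewrite DE; apply: sop_loewner_of => // x; have [y <- ->] := D_min x.
  by apply: le_trans (D'_le y) _; rewrite lerD2r.
move=> rho rho_gt0 rho_le.
have [D' [-> /strongly_positive_opP[D'_sa _] _ D'_min]] :=
  resolvent_comp_variational L_bounded L_below L_norm B_pos rho_gt0.
(* The minimizer for [rho] is a competitor for [gamma], and the nonnegative penalty carries the
   smaller factor [gamma^-1 <= rho^-1]. *)
rewrite DE; apply: sop_loewner_of => // x; have [y <- ->] := D'_min x.
apply: le_trans (D_le y) _; rewrite lerD2l ler_wpM2r ?subr_ge0//.
by rewrite lef_pV2 ?posrE.
Qed.
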